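(* Let $-1\le q\le1$, let $B_1,\dots,B_s\in\mathcal M_{M\times M}(\mathbb R)$ and $\Sigma_1,\dots,\Sigma_s\in\mathcal M_{N\times N}(\mathbb R)$ be positive definite matrices. Let $\lambda\vdash n$, let $\sigma=\sigma_\lambda\in\mathcal F_n^+$, and let $t:\{1,\dots,n\}\to\{1,\dots,s\}$. If $\mathbf W_1\in\mathcal W_q(\Sigma_1,B_1),\dots,\mathbf W_s\in\mathcal W_q(\Sigma_s,B_s)$ are $q$-orthogonal, then $$\tau\big(p_{\sigma,t}(\mathbf W_1,\dots,\mathbf W_s)\big)=\sum_{\gamma\in\mathcal F_n(t)}q^{\mathrm{cr}(\gamma)}\,p_{\gamma,t}(B_1,\dots,B_s)\,p_{\sigma\circledcirc\gamma,\,t(\sigma,\gamma)}(\Sigma_1,\dots,\Sigma_s).$$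
   Context: $q$-Wishart matrices. A noncommutative probability space is a unital complex $*$-algebra $\mathcal A$ with a tracial state $\tau$. Elements $\mathbf X_1,\mathbf X_2,\dots\in\mathcal A$ are (jointly) $q$-Gaussian if $\mathbf X_j=\mathbf X_j^*$ and for any $\mathbf Y_1,\dots,\mathbf Y_n\in\{\mathbf X_1,\mathbf X_2,\dots\}$, $\tau(\mathbf Y_1\cdots\mathbf Y_n)=\sum_{\mathcal V}q^{\mathrm{cr}(\mathcal V)}\prod_{\{i,j\}\in\mathcal V,\,i<j}\tau(\mathbf Y_i\mathbf Y_j)$, the sum over all pair partitions $\mathcal V$ of $\{1,\dots,n\}$ (zero for odd $n$), with $\mathrm{cr}(\mathcal V)=\#\{(i_1,i_2):\{i_1,j_1\},\{i_2,j_2\}\in\mathcal V,\ i_1<i_2<j_1<j_2\}$ the number of crossings, and $0^0=1$. $\mathbf W\in\mathcal W_q(\Sigma,B)$ means $\mathbf W=\mathbf X^*\mathbf X$ (so $[\mathbf W]_{i,j}=\sum_k\mathbf X_{k,i}\mathbf X_{k,j}$), where $\mathbf X=[\mathbf X_{i,j}]$ is an $M\times N$ matrix of jointly $q$-Gaussian elements with $\tau(\mathbf X_{i,j}\mathbf X_{k,m})=[B]_{i,k}[\Sigma]_{j,m}$. $\mathbf W_1,\dots,\mathbf W_s$ are $q$-orthogonal if the entries of all corresponding matrices $\mathbf X^{(1)},\dots,\mathbf X^{(s)}$ are jointly $q$-Gaussian and $\tau(\mathbf X^{(k)}_{i,j}\mathbf X^{(k')}_{i',j'})=[B_k]_{i,i'}[\Sigma_k]_{j,j'}\delta_{k,k'}$.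 Pair partitions. $\mathcal F_n$ is the set of partitions of $\{\pm1,\dots,\pm n\}$ into two-element sets. $\gamma\in\mathcal F_n$ is identified with a fixed-point-free involution ($\gamma(i)=j$ iff $\{i,j\}\in\gamma$) and with a graph on $\{\pm1,\dots,\pm n\}$ whose edges are its pairs. $\delta\in\mathcal F_n$ is $\delta(j)=-j$. $\mathcal F_n^+$ is the set of $\sigma\in\mathcal F_n$ all of whose pairs consist of one positive and one negative integer. For $\gamma\in\mathcal F_n$, $\mathrm{cr}(\gamma)$ is the number of crossings of $\gamma$ as a pair partition of the ordered set $(1,-1,2,-2,\dots,n,-n)$. For a partition $\lambda=(\lambda_1\ge\lambda_2\ge\dots)$ of $n$, $$\sigma_\lambda=\{\{1,-2\},\{2,-3\},\dots,\{\lambda_1,-1\},\{\lambda_1+1,-(\lambda_1+2)\},\dots,\{\lambda_1+\lambda_2,-(\lambda_1+1)\},\dots\}\in\mathcal F_n^+,$$ so that $\pi(\sigma_\lambda)=(1,\dots,\lambda_1)(\lambda_1+1,\dots,\lambda_1+\lambda_2)\cdots$ for $\pi$ defined next. The permutation $\pi(\gamma)\in S_n$ and signs $\varepsilon(\gamma)\in\{+,-\}^n$ are read from the 2-regular graph $\delta\cup\gamma$: let $j$ be the smallest element of $\{1,\dots,n\}$ not yet used, put $v_1=j$ and $v_{k+1}=-\gamma(v_k)$ until the first return $v_{r+1}=v_1$. Then $(|v_1|,\dots,|v_r|)$ is a cycle of $\pi(\gamma)$ and $\varepsilon_{|v_k|}(\gamma)$ is the sign of $v_k$. Repeat until all elements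 are used. $\mathcal C(\gamma)$ is the set of cycles of $\pi(\gamma)$, including fixed points. Brauer product. For $\sigma\in\mathcal F_n^+$, $\gamma\in\mathcal F_n$, the element $\sigma\circledcirc\gamma\in\mathcal F_n$ is $$(\sigma\circledcirc\gamma)(j)=\begin{cases}\sigma(-\gamma(j)), & j>0,\ \gamma(j)<0,\\ \gamma(j), & j>0,\ \gamma(j)>0,\\ \sigma(-\gamma(-\sigma(j))), & j<0,\ \gamma(-\sigma(j))<0,\\ \gamma(-\sigma(j)), & j<0,\ \gamma(-\sigma(j))>0.\end{cases}$$ Colorings. $\mathcal F_n(t)=\{\gamma\in\mathcal F_n: t(|\gamma(j)|)=t(|j|)\text{ for all }j\}$. For $\gamma\in\mathcal F_n(t)$ each edge $\{u,v\}$ of $\gamma$ has color $t(|u|)=t(|v|)$. Each edge of $\sigma\circledcirc\gamma$ comes from exactly one edge $\{u,v\}$ of $\gamma$ (it is $\{\varphi(u),\varphi(v)\}$ with $\varphi(w)=w$ for $w>0$, $\varphi(w)=\sigma(-w)$ for $w<0$) and inherits its color. $t(\sigma,\gamma)(i)$ is the color of the edge of $\sigma\circledcirc\gamma$ crossed when passing from $i$ to the next element of its cycle of $\pi(\sigma\circledcirc\gamma)$ in the traversal of $\delta\cup(\sigma\circledcirc\gamma)$ given by $v_1=j$ (with $j$ the smallest element of $\{1,\dots,n\}$ not yet used), $v_{k+1}=-(\sigma\circledcirc\gamma)(v_k)$ (cross an edge of $\sigma\circledcirc\gamma$, then an edge of $\delta$), i.e. the edge containing $\varepsilon_i(\sigma\circledcirc\gamma)\,i$.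 Explicitly, $t(\sigma,\gamma)(i)=t(i)$ if $\varepsilon_i(\sigma\circledcirc\gamma)=+$ and $t(\sigma,\gamma)(i)=t(\sigma(-i))$ if $\varepsilon_i(\sigma\circledcirc\gamma)=-$. Monomials. $p_{\gamma,t}(\mathbf x_1,\dots,\mathbf x_s)=\prod_{c\in\mathcal C(\gamma)}\mathrm{tr}\big(\prod_{j\in c}\mathbf x_{t(j)}\big)$, with $\mathrm{tr}$ the unnormalized trace (for matrices over $\mathcal A$, $\mathrm{tr}(\mathbf Z)=\sum_i[\mathbf Z]_{i,i}\in\mathcal A$). Each cycle is written starting with its smallest element, the product over a cycle is in the order of the cycle, and the (possibly noncommuting) traces are multiplied in the order of increasing smallest elements of the cycles. Thus $p_{\sigma_\lambda,t}(\mathbf W_1,\dots,\mathbf W_s)=\mathrm{tr}(\mathbf W_{t(1)}\cdots\mathbf W_{t(\lambda_1)})\,\mathrm{tr}(\mathbf W_{t(\lambda_1+1)}\cdots\mathbf W_{t(\lambda_1+\lambda_2)})\cdots$. *)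

(* Defs.v *)
From mathcomp Require Import all_boot all_order all_algebra.
From mathcomp Require Import complex.
From mathcomp Require Import reals.

Set Implicit Arguments.
Unset Strict Implicit.
Unset Printing Implicit Defensive.

Import Order.TTheory GRing.Theory Num.Theory.
Local Open Scope ring_scope.
Local Open Scope complex_scope.

(* A pair partition is represented by the fixed-point-free involution exchanging
   the two elements of each pair. *)
Definition pairings (T : finType) : {set {ffun T -> T}} :=
  [set g : {ffun T -> T} | [forall x, (g x != x) && (g (g x) == x)]].

(* Crossings with respect to the linear order on [T] given by an injective rank
   function; a crossing [i1 < i2 < j1 < j2] is encoded by the pair [(i1, i2)]. *)
Definition crossings (T : finType) (rk : T -> nat) (g : {ffun T -> T}) : nat :=
  #|[set p : T * T |
      [&& (rk p.1 < rk p.2)%N, (rk p.2 < rk (g p.1))%N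
        & (rk (g p.1) < rk (g p.2))%N]]|.

(* [{±1, ..., ±n}]: [(true, i)] is the positive integer [i + 1] and [(false, i)]
   is its opposite. *)
Notation signed n := (bool * 'I_n)%type.

Definition pos n (i : 'I_n) : signed n := (true, i).
Definition neg n (i : 'I_n) : signed n := (false, i).
Definition is_pos n (v : signed n) : bool := v.1.
Definition sabs n (v : signed n) : 'I_n := v.2.
Definition sopp n (v : signed n) : signed n := (~~ v.1, v.2).

Definition F (n : nat) : {set {ffun signed n -> signed n}} :=
  pairings (signed n).

Definition Fplus (n : nat) : {set {ffun signed n -> signed n}} :=
  [set g in F n | [forall v, is_pos (g v) == ~~ is_pos v]].

Definition Fcol n s (t : 'I_n -> 'I_s) : {set {ffun signed n -> signed n}} :=
  [set g in F n | [forall v, t (sabs (g v)) == t (sabs v)]].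

(* The rank in the ordered set [(1, -1, 2, -2, ..., n, -n)]. *)
Definition srank n (v : signed n) : nat := ((sabs v).*2 + ~~ is_pos v)%N.

Definition cr n (g : {ffun signed n -> signed n}) : nat := crossings (@srank n) g.

Definition step n (g : {ffun signed n -> signed n}) (v : signed n) : signed n :=
  sopp (g v).

Definition traversal n (g : {ffun signed n -> signed n}) : seq (seq (signed n)) :=
  foldl (fun cs j =>
           if j \in [seq sabs v | v <- flatten cs] then cs
           else rcons cs (orbit (step g) (pos j)))
        [::] (enum 'I_n).

(* [C(γ)]: the cycles of [π(γ)], each starting with its smallest element, and
   listed by increasing smallest elements. *)
Definition cycles n (g : {ffun signed n -> signed n}) : seq (seq 'I_n) :=
  [seq [seq sabs v | v <- c] | c <- traversal g].

(* [true] stands for [+]. *)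
Definition eps n (g : {ffun signed n -> signed n}) (i : 'I_n) : bool :=
  pos i \in flatten (traversal g).

Definition is_partition (lam : seq nat) (n : nat) : bool :=
  [&& sorted geq lam, 0%N \notin lam & sumn lam == n].

(* The block of consecutive integers of [λ] containing [i]. *)
Definition lam_block n (lam : seq nat) (i : 'I_n) : seq 'I_n :=
  nth [::] (reshape lam (enum 'I_n)) (reshape_index lam i).

(* [next] and [prev] are the cyclic successor and predecessor in a list. *)
Definition sigma_lam n (lam : seq nat) : {ffun signed n -> signed n} :=
  [ffun v => if is_pos v then neg (next (lam_block lam (sabs v)) (sabs v))
             else pos (prev (lam_block lam (sabs v)) (sabs v))].

Definition brauer n (sg g : {ffun signed n -> signed n}) :
    {ffun signed n -> signed n} :=
  [ffun j =>
     if is_pos j then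
       if is_pos (g j) then g j else sg (sopp (g j))
     else
       if is_pos (g (sopp (sg j))) then g (sopp (sg j))
       else sg (sopp (g (sopp (sg j))))].

Definition phi n (sg : {ffun signed n -> signed n}) (w : signed n) : signed n :=
  if is_pos w then w else sg (sopp w).

(* The color of the edge of [brauer sg g] crossed when leaving [i], that is, the
   edge containing [eps_i i]; see [tcol_edge]. *)
Definition tcol n s (sg g : {ffun signed n -> signed n}) (t : 'I_n -> 'I_s)
    (i : 'I_n) : 'I_s :=
  if eps (brauer sg g) i then t i else t (sabs (sg (neg i))).

(* The \prod over a list is taken in the order of the list. *)
Definition pmon (K : nzRingType) n s d (g : {ffun signed n -> signed n})
    (t : 'I_n -> 'I_s) (x : 'I_s -> 'M[K]_d) : K :=
  \prod_(c <- cycles g) \tr (\prod_(j <- c) x (t j)).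

Definition posdef (R : realType) d (A : 'M[R]_d) : Prop :=
  A^T = A /\ forall x : 'cV[R]_d, x != 0 -> 0 < (x^T *m A *m x) 0 0.

Record star_algebra (R : realType) (A : algType R[i]) (star : A -> A) : Prop :=
  StarAlgebra {
    starK : forall a, star (star a) = a;
    starD : forall a b, star (a + b) = star a + star b;
    starZ : forall (c : R[i]) a, star (c *: a) = c^* *: star a;
    starM : forall a b, star (a * b) = star b * star a
  }.

Record tracial_state (R : realType) (A : algType R[i]) (star : A -> A)
    (tau : {scalar A}) : Prop :=
  TracialState {
    tau1 : tau 1 = 1;
    tau_ge0 : forall a, 0 <= tau (star a * a);
    tauC : forall a b, tau (a * b) = tau (b * a)
  }.

Section QWishart.
Variables (R : realType) (A : algType R[i]) (star : A -> A) (tau : {scalar A}).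
Variable q : R.

(* There is no pairing of ['I_n] for odd [n], so odd moments vanish; and
   [0 ^+ 0 = 1]. *)
Definition qGaussian (I : Type) (X : I -> A) : Prop :=
  (forall i, star (X i) = X i) /\
  forall (n : nat) (y : 'I_n -> I),
    tau (\prod_(k < n) X (y k)) =
    \sum_(g in pairings 'I_n)
       q%:C ^+ crossings (@nat_of_ord n) g *
       \prod_(k < n | (k < g k)%N) tau (X (y k) * X (y (g k))).

Variables (M N : nat).

Definition wishart_with (Sigma : 'M[R]_N) (B : 'M[R]_M) (W : 'M[A]_N)
    (X : 'M[A]_(M, N)) : Prop :=
  [/\ W = (map_mx star X)^T *m X,
      qGaussian (fun e : 'I_M * 'I_N => X e.1 e.2)
    & forall i j k m, tau (X i j * X k m) = (B i k * Sigma j m)%:C].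

Definition qWishart (Sigma : 'M[R]_N) (B : 'M[R]_M) (W : 'M[A]_N) : Prop :=
  exists X : 'M[A]_(M, N), wishart_with Sigma B W X.

Definition q_orthogonal s (Sigma : 'I_s -> 'M[R]_N) (B : 'I_s -> 'M[R]_M)
    (W : 'I_s -> 'M[A]_N) : Prop :=
  exists X : 'I_s -> 'M[A]_(M, N),
    [/\ forall k, wishart_with (Sigma k) (B k) (W k) (X k),
        qGaussian (fun e : 'I_s * 'I_M * 'I_N => X e.1.1 e.1.2 e.2)
      & forall k k' i j i' j',
          tau (X k i j * X k' i' j') =
          (B k i i' * Sigma k j j' * (k == k')%:R)%:C].

End QWishart.

Lemma pairingsP (T : finType) (g : {ffun T -> T}) :
  reflect ((forall x, g x != x) /\ involutive g) (g \in pairings T).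
Proof.
rewrite inE; apply: (iffP forallP) => [h|[h1 h2] x]; last by rewrite h1 h2 eqxx.
by split=> x; have /andP[? /eqP] := h x.
Qed.

Lemma FplusP n (g : {ffun signed n -> signed n}) :
  reflect (involutive g /\ forall v, is_pos (g v) = ~~ is_pos v) (g \in Fplus n).
Proof.
rewrite inE; apply: (iffP andP) => [[/pairingsP[_ h] /forallP h']|[h h']].
  by split=> // v; apply/eqP.
split; last by apply/forallP => v; rewrite h'.
apply/pairingsP; split=> // v; apply/eqP => e.
by have := h' v; rewrite e; case: is_pos.
Qed.

Lemma soppK n : involutive (@sopp n).
Proof. by case=> b i; rewrite /sopp /= negbK. Qed.

Lemma is_pos_sopp n (v : signed n) : is_pos (sopp v) = ~~ is_pos v.
Proof. by []. Qed.

Lemma phi_inj n (sg : {ffun signed n -> signed n}) :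
  sg \in Fplus n -> injective (phi sg).
Proof.
move=> /FplusP[sgK sgN] u v; rewrite /phi.
case: ifPn => pu; case: ifPn => pv //.
- by move=> e; move: pu; rewrite e sgN is_pos_sopp negbK (negbTE pv).
- by move=> e; move: pv; rewrite -e sgN is_pos_sopp negbK (negbTE pu).
- by move/(can_inj sgK)/(can_inj (@soppK n)).
Qed.

Lemma brauer_phi n (sg g : {ffun signed n -> signed n}) (u : signed n) :
  sg \in Fplus n -> brauer sg g (phi sg u) = phi sg (g u).
Proof.
move=> /FplusP[sgK sgN]; rewrite ffunE /phi.
case: (boolP (is_pos u)) => pu; first by rewrite pu.
by rewrite sgN is_pos_sopp negbK (negbTE pu) sgK soppK.
Qed.

Lemma brauer_F n (sg g : {ffun signed n -> signed n}) :
  sg \in Fplus n -> g \in F n -> brauer sg g \in F n.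
Proof.
move=> sgF /pairingsP[gx gK].
have surj v : exists u, v = phi sg u.
  have [r _ rK] := injF_bij (phi_inj sgF).
  by exists (r v).
apply/pairingsP; split=> v; have [u ->] := surj v; rewrite !brauer_phi //.
  by rewrite (inj_eq (phi_inj sgF)).
by rewrite gK.
Qed.

Lemma tcol_edge n s (sg g : {ffun signed n -> signed n}) (t : 'I_n -> 'I_s)
    (i : 'I_n) (u : signed n) :
  sg \in Fplus n -> phi sg u = (eps (brauer sg g) i, i) ->
  tcol sg g t i = t (sabs u).
Proof.
move=> /FplusP[sgK sgN]; rewrite /tcol /phi.
case: ifPn => pu e.
  by move: pu; rewrite e /is_pos /= => ->.
have := sgN (sopp u); rewrite e is_pos_sopp negbK (negbTE pu) /is_pos /= => h.
by rewrite h; move: e; rewrite h -[(false, i)]/(neg i) => <-; rewrite sgK.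
Qed.

Section SigmaLam.
Variables (n : nat) (lam : seq nat).
Hypothesis hlam : is_partition lam n.

Let sum_lam : sumn lam = n.
Proof. by have /and3P[_ _ /eqP] := hlam. Qed.

Let shapeE : shape (reshape lam (enum 'I_n)) = lam.
Proof. by rewrite reshapeKl // size_enum_ord sum_lam. Qed.

Let flattenE : flatten (reshape lam (enum 'I_n)) = enum 'I_n.
Proof. by rewrite reshapeKr // size_enum_ord sum_lam. Qed.

Let size_blk r : size (nth [::] (reshape lam (enum 'I_n)) r) = nth 0%N lam r.
Proof.
rewrite -[in RHS]shapeE; case: (ltnP r (size (reshape lam (enum 'I_n)))) => h.
  by rewrite (nth_map [::]).
by rewrite !nth_default // size_map.
Qed.

Lemma mem_lam_block (i : 'I_n) : i \in lam_block lam i.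
Proof.
have := nth_flatten i (reshape lam (enum 'I_n)) i.
rewrite /= shapeE flattenE nth_ord_enum /lam_block => {1}->.
by apply: mem_nth; rewrite size_blk reshape_offsetP // sum_lam.
Qed.

Lemma eq_lam_block (i j : 'I_n) :
  j \in lam_block lam i -> lam_block lam j = lam_block lam i.
Proof.
rewrite {1 3}/lam_block; set r := reshape_index lam i; set b := nth _ _ r => jb.
have lt_c : (index j b < nth 0%N lam r)%N by rewrite -size_blk index_mem.
have jE : nat_of_ord j = flatten_index lam r (index j b).
  have := nth_flatten j (reshape lam (enum 'I_n)) (flatten_index lam r (index j b)).
  rewrite /= shapeE flattenE flatten_indexKl // flatten_indexKr // nth_index //.
  have lt : (flatten_index lam r (index j b) < n)%N.
    rewrite -[X in (_ < X)%N]sum_lam; exact: flatten_indexP.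
  by rewrite (nth_ord_enum j (Ordinal lt)) => /(congr1 val) /= ->.
by rewrite /lam_block jE flatten_indexKl.
Qed.

Let uniq_block (i : 'I_n) : uniq (lam_block lam i).
Proof.
by rewrite /lam_block nth_reshape take_uniq // drop_uniq // enum_uniq.
Qed.

Lemma sigma_lam_Fplus : sigma_lam n lam \in Fplus n.
Proof.
apply/FplusP; split=> [[[] i]|[[] i]]; rewrite !ffunE //= /sigma_lam /neg /pos /=.
  by rewrite (eq_lam_block (i := i)) ?mem_next ?mem_lam_block // prev_next // uniq_block.
by rewrite (eq_lam_block (i := i)) ?mem_prev ?mem_lam_block // next_prev // uniq_block.
Qed.

End SigmaLam.

(* Main.v *)
Require Import Defs.
From mathcomp Require Import all_boot all_order all_algebra.
From mathcomp Require Import complex.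
From mathcomp Require Import reals.
Import Order.TTheory GRing.Theory Num.Theory.
Local Open Scope ring_scope.
Local Open Scope complex_scope.

Set Implicit Arguments.
Unset Strict Implicit.
Unset Printing Implicit Defensive.

(** Write [W_k = X_k^* X_k] entrywise.  For σ = σ_λ, the monomial [pmon σ t W]
is a sum over column indices [b] and row indices [a], both functions on
{1, ..., n}, of words

  X(1) X(-1) X(2) X(-2) ... X(n) X(-n)

in the entries of the matrices [X_k]: the letter at the signed position [v] has
color t(|v|), row index a(|v|), and column index b(|φ(v)|), where φ is the map
that defines the Brauer product.  Indeed the column index of the letter at -j is
shared with the letter at the successor of j in its block, which is |σ(j)|.

The q-Gaussian moment formula turns each word into a sum over the pair
partitions γ of the signed positions, weighted by q^cr(γ), of the products over
the edges {u, v} of γ of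

  B(a(|u|), a(|v|)) * Sigma(b(|φ(u)|), b(|φ(v)|)) * [t(|u|) = t(|v|)].

The last factor restricts the sum to the γ compatible with the coloring, and
for such a γ the sums over [a] and [b] separate.  The sum over [a] runs over
products along the edges of γ, the one over [b] along the edges of σ⊚γ, which are
the images of those of γ under φ.

It remains to see that, for symmetric matrices, such a sum of products along
edges is a product of traces ([pmon_edges]).  Traversing δ ∪ γ crosses every edge
of γ exactly once, because v and -v never belong to the same orbit of
v ↦ -γ(v) ([iter_step_neq_sopp]); the edges crossed along an orbit are
consecutive entries of a closed matrix product, which is what the trace of a
product expands to ([prod_trace_cycles]).  This last expansion holds for
noncommuting entries and keeps the order of the factors, so it also gives the
initial expansion of [pmon σ t W]. *)

(** * Products of traces as sums over index functions *)

Section Assignments.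
Variables (I J : finType) (K : nzRingType).
Implicit Types (b : {ffun I -> J}) (F G : {ffun I -> J} -> K) (s : seq I).

Definition update b i y : {ffun I -> J} :=
  [ffun k => if k == i then y else b k].

Lemma update_out b i y k : k != i -> update b i y k = b k.
Proof. by move=> ki; rewrite ffunE (negbTE ki). Qed.

(** Summing over one coordinate at a time, in the order of a list, makes the
expansion of a trace an induction on its cycle, and the independence of the
disjoint cycles a matter of pulling out factors that ignore a coordinate. *)
Fixpoint asum s F b : K :=
  if s is i :: s' then \sum_(y : J) asum s' F (update b i y) else F b.

Lemma asum_cat s1 s2 F b : asum (s1 ++ s2) F b = asum s1 (asum s2 F) b.
Proof. by elim: s1 b => //= i s IH b; apply: eq_bigr => y _. Qed.

Lemma eq_asum s F G b : F =1 G -> asum s F b = asum s G b.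
Proof. by move=> FG; elim: s b => //= i s IH b; apply: eq_bigr. Qed.

Lemma asumMr s F a b : asum s (fun c => F c * a) b = asum s F b * a.
Proof.
elim: s b => //= i s IH b.
by rewrite mulr_suml; apply: eq_bigr => y _; rewrite IH.
Qed.

Lemma asumMl s F G b :
    (forall c i y, i \in s -> F (update c i y) = F c) ->
  asum s (fun c => F c * G c) b = F b * asum s G b.
Proof.
elim: s b => //= i s IH b FE.
rewrite mulr_sumr; apply: eq_bigr => y _.
rewrite IH => [|c k z ks]; first by rewrite FE ?mem_head.
by rewrite FE // inE ks orbT.
Qed.

Lemma asumE s F b : uniq s ->
  asum s F b = \sum_(c : {ffun I -> J} | [forall i, (i \notin s) ==> (c i == b i)]) F c.
Proof.
elim: s b => [|i s IH] b /=.
  move=> _; rewrite (big_pred1 b) // => c; apply/forallP/eqP => [h|-> //].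
  by apply/ffunP => k; apply/eqP/h.
case/andP=> is_ us; rewrite (partition_big (fun c : {ffun I -> J} => c i) predT) //=.
apply: eq_bigr => y _; rewrite IH //; apply: eq_bigl => c.
apply/forallP/andP => [h|[/forallP h /eqP ci] k].
  have ci : c i = y by have := h i; rewrite is_ ffunE eqxx => /eqP.
  split; last by rewrite ci.
  apply/forallP => k; rewrite inE negb_or; apply/implyP=> /andP[ki ks].
  by have := h k; rewrite ks ffunE (negbTE ki).
apply/implyP=> ks; rewrite ffunE; case: (eqVneq k i) => [->|ki]; first by rewrite ci.
by have := h k; rewrite inE negb_or ki ks.
Qed.

End Assignments.

Section TraceExpansion.
Variables (I : finType) (K : nzRingType) (d : nat).
Variables (nx : I -> I) (x : I -> 'M[K]_d).
Implicit Types (b : {ffun I -> 'I_d}) (s : seq I).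

Let term b j := x j (b j) (b (nx j)).

(** The entries of a matrix product are sums over the indices strictly inside
the path; the indices at its ends [i] and [l] are read off [b].  Allowing
[l = i] is what lets the path close up to a trace. *)
Lemma asum_path i s l b :
    uniq (i :: s) -> l \notin s -> fpath nx i (rcons s l) ->
  asum s (fun c => \prod_(j <- i :: s) term c j) b
    = (\prod_(j <- i :: s) x j) (b i) (b l).
Proof.
elim: s i b => [|k s IH] i b.
  by move=> _ _ /= /andP[/eqP nxi _]; rewrite !big_seq1 /term nxi.
rewrite [uniq _]/=; case/and3P=> iks ks us lks /= /andP[/eqP nxi pth].
have [ik is_] : i != k /\ i \notin s by move: iks; rewrite inE negb_or => /andP[].
have [lk ls] : l != k /\ l \notin s by move: lks; rewrite inE negb_or => /andP[].
rewrite big_cons mxE; apply: eq_bigr => y _.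
set b' := update b k y.
have -> : b i = b' i by rewrite update_out.
have -> : b l = b' l by rewrite update_out.
have -> : y = b' k by rewrite ffunE eqxx.
rewrite -IH //=; last by rewrite ks us.
have -> : x i (b' i) (b' k) = term b' i by rewrite /term nxi.
rewrite -(@asumMl _ _ _ _ (term^~ i)) => [|c j z js].
  by apply: eq_asum => c; rewrite big_cons.
rewrite /term nxi !update_out //.
  by apply: contraNneq ks => ->.
by apply: contraNneq is_ => ->.
Qed.

Lemma asum_cycle (c : seq I) b : c != [::] -> uniq c -> fcycle nx c ->
  asum c (fun b => \prod_(j <- c) term b j) b = \tr (\prod_(j <- c) x j).
Proof.
case: c => // i s _ us cyc; rewrite /= /mxtrace; apply: eq_bigr => y _.
rewrite (@asum_path _ _ i) //; last by case/andP: us.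
by rewrite ffunE eqxx.
Qed.

(** The value does not depend on the base assignment [b], since every
coordinate that occurs is summed over; this is why, in the induction, the
product over the remaining cycles comes out as a constant. *)
Lemma asum_cycles (cs : seq (seq I)) b :
    uniq (flatten cs) -> all (fun c => (c != [::]) && fcycle nx c) cs ->
  asum (flatten cs) (fun b => \prod_(j <- flatten cs) term b j) b
    = \prod_(c <- cs) \tr (\prod_(j <- c) x j).
Proof.
elim: cs b => [|c cs IH] b; first by rewrite /= !big_nil.
rewrite /= cat_uniq => /and3P[uc dis ucs] /andP[/andP[c0 cyc] hcs].
rewrite big_cons asum_cat.
rewrite -(asum_cycle b c0 uc cyc) -asumMr; apply: eq_asum => b'.
rewrite -(IH b') // -(@asumMl _ _ _ _ (fun b => \prod_(j <- c) term b j)) => [|c' i y ics].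
  by apply: eq_asum => c'; rewrite big_cat.
have ic : i \notin c by apply: contra dis => ic; apply/hasP; exists i.
rewrite !(big_seq_cond xpredT); apply: eq_bigr => j; rewrite andbT => jc.
have ji : j != i by apply: contraNneq ic => <-.
have nji : nx j != i.
  by apply: contraNneq ic => <-; rewrite (eqP (next_cycle cyc jc)) mem_next.
by rewrite /term !update_out.
Qed.

(** The entries may fail to commute: the factors appear on the right in the
order in which the cycles list the indices. *)
Lemma prod_trace_cycles (cs : seq (seq I)) :
    uniq (flatten cs) -> (forall i, i \in flatten cs) ->
    all (fun c => (c != [::]) && fcycle nx c) cs ->
  \prod_(c <- cs) \tr (\prod_(j <- c) x j)
    = \sum_(b : {ffun I -> 'I_d}) \prod_(j <- flatten cs) x j (b j) (b (nx j)).
Proof.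
move=> ucs full hcs.
case: (pickP (fun _ : {ffun I -> 'I_d} => true)) => [b _|nob].
  rewrite -(asum_cycles b ucs hcs) asumE //; apply: eq_bigl => c.
  by apply/forallP=> i; rewrite full.
(* No index function exists, so d = 0 and some trace is an empty sum. *)
rewrite [RHS]big_pred0 //.
case: cs ucs full hcs => [|c cs] _ full _.
  have f0 : I -> 'I_d by move=> i; have := full i.
  by have := nob (finfun f0).
case: d x nob => [|d'] x' nob; first by rewrite big_cons /mxtrace big_ord0 mul0r.
by have := nob [ffun => ord0].
Qed.

End TraceExpansion.

(** * The traversal of a pair partition *)

Lemma map_uniq_inj (T1 T2 : eqType) (f : T1 -> T2) (s : seq T1) :
  uniq (map f s) -> {in s &, injective f}.
Proof.
move=> us x y xs ys e; apply: (index_inj x xs ys); apply/eqP.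
rewrite -(nth_uniq (f x) _ _ us) ?size_map ?index_mem //.
by rewrite !(nth_map x) ?index_mem // !nth_index // e.
Qed.

Section Traversal.
Variables (n : nat) (g : {ffun signed n -> signed n}).
Hypothesis gF : g \in F n.

Let gx v : g v != v. Proof. by have /pairingsP[h _] := gF. Qed.
Let gK : involutive g. Proof. by have /pairingsP[_ h] := gF. Qed.

Lemma step_inj : injective (step g).
Proof. by move=> u v /(can_inj (@soppK n))/(can_inj gK). Qed.

Lemma step_sopp_step v : step g (sopp (step g v)) = sopp v.
Proof. by rewrite /step soppK gK. Qed.

Lemma step_neq_sopp v : step g v != sopp v.
Proof. by rewrite /step (can_eq (@soppK n)) gx. Qed.

Lemma sopp_neq (v : signed n) : v != sopp v.
Proof. by case: v => -[] i. Qed.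

(** The involution [sopp] reverses the orbits of [step g]: both [sopp] and [g]
are involutions and [step g] is their composite, so they generate a dihedral
group. *)
Lemma iter_step_sopp k v :
  iter k (step g) (sopp (iter k (step g) v)) = sopp v.
Proof.
by elim: k v => //= k IH v; rewrite -iterS iterSr step_sopp_step IH.
Qed.

(** If v is at distance k from -v, then the two points one step inside, [step v]
and its opposite, are at distance k - 2.  So the shortest such segment has
length 0 or 1, which would give a fixed point of [sopp] or of [g]. *)
Lemma iter_step_neq_sopp k v : iter k (step g) v != sopp v.
Proof.
have [m] := ubnP k; elim: m k v => // m IH [|[|k]] v; rewrite ?ltnS => km.
- exact: sopp_neq.
- exact: step_neq_sopp.
rewrite iterSr iterS -(step_sopp_step v) (inj_eq step_inj).
by apply: IH; apply: leq_trans km.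
Qed.

Lemma fconnect_sopp u v :
  fconnect (step g) u v -> fconnect (step g) (sopp v) (sopp u).
Proof.
move/iter_findex; move: (findex _ u v) => k <-.
by rewrite -[X in fconnect _ _ X](iter_step_sopp k u) fconnect_iter.
Qed.

Lemma fconnect_soppF v : fconnect (step g) v (sopp v) = false.
Proof.
apply/negP => /iter_findex e.
by have := iter_step_neq_sopp (findex (step g) v (sopp v)) v; rewrite e eqxx.
Qed.

Let fsym := fconnect_sym step_inj.

Lemma sabs_eq (u v : signed n) : sabs u = sabs v -> u = v \/ u = sopp v.
Proof. by case: u v => [[] i] [[] j] /= ->; [left|right|right|left]. Qed.

Let add_cycle := fun (cs : seq (seq (signed n))) j =>
  if j \in [seq sabs v | v <- flatten cs] then cs
  else rcons cs (orbit (step g) (pos j)).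

(** The invariant of the traversal.  The absolute values met so far stay
distinct: a new orbit contains no pair of opposite elements by
[fconnect_soppF], and if it met an earlier orbit up to sign, then the earlier
orbit, being closed under [step g], would already contain its base point up to
sign. *)
Lemma foldl_add_cycle (s : seq 'I_n) :
  let cs := foldl add_cycle [::] s in
  [/\ uniq (map (@sabs n) (flatten cs)),
      forall u v, u \in flatten cs -> fconnect (step g) u v -> v \in flatten cs,
      {subset s <= map (@sabs n) (flatten cs)}
    & forall c, c \in cs -> exists v, c = orbit (step g) v].
Proof.
elim/last_ind: s => [|s j]; first by split.
rewrite foldl_rcons /=; set cs := foldl _ _ s => -[ucs closed sub orb].
rewrite /add_cycle; case: ifPn => jcs.
  split=> // i; rewrite mem_rcons inE => /predU1P[->//|]; exact: sub.
have flE : flatten (rcons cs (orbit (step g) (pos j)))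
           = flatten cs ++ orbit (step g) (pos j).
  by rewrite -cats1 flatten_cat /= cats0.
split.
- rewrite flE map_cat cat_uniq ucs /=; apply/andP; split; last first.
    rewrite map_inj_in_uniq ?orbit_uniq // => u v.
    rewrite -!fconnect_orbit => ju jv /sabs_eq[//|uv].
    have : fconnect (step g) v (sopp v).
      by rewrite -uv; apply: connect_trans ju; rewrite fsym.
    by rewrite fconnect_soppF.
  apply: contra jcs => /hasP[i /mapP[u + ->{i}]].
  rewrite -fconnect_orbit => ju /mapP[w wcs /sabs_eq[uw|uw]]; apply/mapP.
    by exists (pos j) => //; apply: (closed w) => //; rewrite -uw fsym.
  exists (sopp (pos j)) => //; apply: (closed w) => //.
  by rewrite -[w]soppK -uw; apply: fconnect_sopp.
- move=> u v; rewrite flE !mem_cat -!fconnect_orbit.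
  case/orP=> [ucs' uv|ju uv]; first by rewrite (closed u).
  by rewrite (connect_trans ju uv) orbT.
- move=> i; rewrite mem_rcons inE flE map_cat mem_cat => /predU1P[->|/sub->//].
  by apply/orP; right; apply/mapP; exists (pos j) => //; rewrite -fconnect_orbit.
by move=> c; rewrite mem_rcons inE => /predU1P[->|/orb//]; exists (pos j).
Qed.

Lemma flatten_cycles : flatten (cycles g) = map (@sabs n) (flatten (traversal g)).
Proof. by rewrite map_flatten. Qed.

Lemma uniq_flatten_cycles : uniq (flatten (cycles g)).
Proof. by rewrite flatten_cycles; have [] := foldl_add_cycle (enum 'I_n). Qed.

Lemma mem_flatten_cycles i : i \in flatten (cycles g).
Proof.
rewrite flatten_cycles; have [_ _ sub _] := foldl_add_cycle (enum 'I_n).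
by apply: sub; rewrite mem_enum.
Qed.

Lemma step_traversal v :
  (step g v \in flatten (traversal g)) = (v \in flatten (traversal g)).
Proof.
have [_ closed _ _] := foldl_add_cycle (enum 'I_n).
apply/idP/idP => vT; apply: closed vT _; last exact: fconnect1.
by rewrite fsym fconnect1.
Qed.

(** Hence the traversal picks one sign for each integer, and, by [g_traversal]
below, one end of each edge. *)
Lemma sopp_traversal v :
  (sopp v \in flatten (traversal g)) = (v \notin flatten (traversal g)).
Proof.
have := uniq_flatten_cycles; rewrite flatten_cycles => /map_uniq_inj sI.
have := mem_flatten_cycles (sabs v); rewrite flatten_cycles => /mapP[w wT wv].
apply/idP/idP => [svT|vT].
  apply/negP => vT; have := sI _ _ svT vT erefl => e.
  by have := sopp_neq v; rewrite e eqxx.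
have [e|e] := sabs_eq (esym wv); first by rewrite -e wT in vT.
by rewrite -e.
Qed.

Lemma mem_traversal v : (v \in flatten (traversal g)) = (v == (eps g (sabs v), sabs v)).
Proof.
case: v => -[] i; rewrite xpair_eqE /= eqxx andbT eq_sym /eps.
  by case: (_ \in _).
by rewrite -[(false, i)]/(sopp (pos i)) sopp_traversal; case: (_ \in _).
Qed.

Lemma g_traversal v :
  (g v \in flatten (traversal g)) = (v \notin flatten (traversal g)).
Proof.
by rewrite -(step_traversal v) sopp_traversal negbK.
Qed.

(** This is π(γ): the sign [eps g i] tells on which of ±i the traversal stands
when it leaves i. *)
Definition pi_of i : 'I_n := sabs (g (eps g i, i)).

Lemma cycles_fcycle :
  all (fun c => (c != [::]) && fcycle pi_of c) (cycles g).
Proof.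
apply/allP => _ /mapP[c cT ->].
have [_ _ _ /(_ c cT)[v cE]] := foldl_add_cycle (enum 'I_n).
have c0 : c != [::] by rewrite cE /orbit -orderSpred.
apply/andP; split; first by case: c c0 {cT cE}.
have cyc : fcycle (step g) c by rewrite cE; apply: cycle_orbit; apply: step_inj.
rewrite cycle_map; apply: sub_in_cycle cyc => [u w uT _|]; last first.
  by apply/allP=> u uc; apply/flattenP; exists c; [exact: cT|exact: uc].
move=> /eqP <-; rewrite /pi_of /=.
move: uT; rewrite mem_traversal => /eqP {1}<-.
by [].
Qed.

End Traversal.

(** * Trace monomials as sums over edges *)

Section PmonExpansion.
Variables (n s d : nat) (g : {ffun signed n -> signed n}).
Hypothesis gF : g \in F n.

Lemma pmon_cycles (K : nzRingType) (t : 'I_n -> 'I_s) (x : 'I_s -> 'M[K]_d) :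
  pmon g t x = \sum_(a : {ffun 'I_n -> 'I_d})
    \prod_(j <- flatten (cycles g)) x (t j) (a j) (a (pi_of g j)).
Proof.
apply: (@prod_trace_cycles _ _ _ (pi_of g) (fun j => x (t j))).
- exact: uniq_flatten_cycles.
- exact: mem_flatten_cycles.
exact: cycles_fcycle.
Qed.

Variable K : comNzRingType.

(** [T1] and [T2] each select one end of every edge, and [f] takes the same
value at both ends, so each product runs over the edges. *)
Lemma prod_half_edges (f : signed n -> K) (T1 T2 : pred (signed n)) :
    (forall v, f (g v) = f v) ->
    (forall v, T1 (g v) = ~~ T1 v) -> (forall v, T2 (g v) = ~~ T2 v) ->
  \prod_(v | T1 v) f v = \prod_(v | T2 v) f v.
Proof.
move=> fg gT1 gT2; have /pairingsP[_ gK] := gF.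
rewrite (bigID T2) [RHS](bigID T1) /=; congr (_ * _).
  by apply: eq_bigl => v; rewrite andbC.
rewrite [RHS](reindex_inj (can_inj gK)) /=; apply: eq_big => v.
  by rewrite gT1 gT2 negbK andbC.
by rewrite fg.
Qed.

(** A factor [x a_u a_v] belongs to an edge {u, v} without orientation because
[x] is symmetric.  So the ends chosen by the traversal, which turn the product
into traces, can be exchanged for those chosen by any [T], such as the left ends
that occur in the moment formula. *)
Lemma pmon_edges (T : pred (signed n)) (col : signed n -> 'I_s)
    (t : 'I_n -> 'I_s) (x : 'I_s -> 'M[K]_d) :
    (forall v, T (g v) = ~~ T v) -> (forall v, col (g v) = col v) ->
    (forall i, t i = col (eps g i, i)) -> (forall k, (x k)^T = x k) ->
  pmon g t x = \sum_(a : {ffun 'I_n -> 'I_d})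
    \prod_(v | T v) x (col v) (a (sabs v)) (a (sabs (g v))).
Proof.
move=> gT gcol tE xT; have /pairingsP[_ gK] := gF.
rewrite pmon_cycles; apply: eq_bigr => a _.
rewrite flatten_cycles big_map big_uniq /=; last first.
  by have := uniq_flatten_cycles gF; rewrite flatten_cycles; apply: map_uniq.
pose f v := x (col v) (a (sabs v)) (a (sabs (g v))).
transitivity (\prod_(v in flatten (traversal g)) f v).
  apply: eq_bigr => v; rewrite mem_traversal // /f /pi_of tE.
  by move=> /eqP <-.
apply: prod_half_edges => // v; last by rewrite g_traversal.
by rewrite /f gcol gK -[in LHS]xT mxE.
Qed.

End PmonExpansion.

(** * The cycles of the pairing of an integer partition *)

Section SigmaCycles.
Variables (n : nat) (lam : seq nat).
Hypothesis hlam : is_partition lam n.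
Let sg := sigma_lam n lam.

(** The traversal visits the starting points in increasing order, and the blocks
are listed in that order: the head of each block opens a new orbit, and the other
elements of the block are then skipped. *)
Lemma traversal_blocks (g : {ffun signed n -> signed n}) (cs : seq (seq 'I_n)) :
    flatten cs = enum 'I_n ->
    (forall c, c \in cs -> c != [::] /\ fcycle (step g) (map (@pos n) c)) ->
  traversal g = map (map (@pos n)) cs.
Proof.
move=> csE; rewrite /traversal -csE; have := enum_uniq 'I_n; rewrite -csE {csE}.
rewrite -[RHS]cat0s.
have: all (fun i => i \notin map (@sabs n) (flatten [::])) (flatten cs).
  exact/allP.
elim: cs [::] => [|c cs IH] acc; first by rewrite cats0.
rewrite [flatten (c :: cs)]/= all_cat cat_uniq foldl_cat.
move=> /andP[acc_c acc_cs] /and3P[uc dis ucs] hcs.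
have [c0 cyc] := hcs c (mem_head _ _).
have -> : foldl (fun cs j =>
            if j \in [seq sabs v | v <- flatten cs] then cs
            else rcons cs (orbit (step g) (pos j))) acc c
          = rcons acc (map (@pos n) c).
  case: c c0 uc cyc acc_c {dis hcs} => // i c _ uc cyc /= /andP[/negbTE-> _].
  have -> : orbit (step g) (pos i) = map (@pos n) (i :: c).
    have upos : uniq (map (@pos n) (i :: c)).
      by rewrite map_inj_uniq // => j k [].
    by rewrite (orbitE cyc upos) ?mem_head // /= eqxx rot0.
  have: {subset c <= map (@sabs n) (flatten (rcons acc (map (@pos n) (i :: c))))}.
    move=> k kc; rewrite -cats1 flatten_cat map_cat mem_cat /= cats0.
    by rewrite inE -map_comp map_id kc !orbT.
  elim: {uc cyc}c (rcons _ _) => //= k c' IHc acc' sub.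
  by rewrite sub ?mem_head // IHc // => m mc; rewrite sub // inE mc orbT.
rewrite IH //=; first by rewrite cat_rcons.
  apply/allP=> k kcs; rewrite -cats1 flatten_cat map_cat mem_cat negb_or.
  rewrite (allP acc_cs) //= cats0 -map_comp map_id.
  by apply: contra dis => kc; apply/hasP; exists k.
by move=> c' c'cs; apply: hcs; rewrite inE c'cs orbT.
Qed.

Let R := reshape lam (enum 'I_n).

Let sum_lam : sumn lam = n.
Proof. by have /and3P[_ _ /eqP] := hlam. Qed.

Let shapeE : shape R = lam.
Proof. by rewrite reshapeKl // size_enum_ord sum_lam. Qed.

Let flattenE : flatten R = enum 'I_n.
Proof. by rewrite reshapeKr // size_enum_ord sum_lam. Qed.

Lemma lam_block_reshape c i : c \in R -> i \in c -> lam_block lam i = c.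
Proof.
move=> cR ic; have := nth_index [::] cR; set r := index c R => cE.
have lt_k : (index i c < nth 0%N lam r)%N.
  by rewrite -shapeE (nth_map [::]) ?index_mem // cE index_mem.
have iE : nat_of_ord i = flatten_index lam r (index i c).
  have := nth_flatten i R (flatten_index lam r (index i c)).
  rewrite /= shapeE flattenE flatten_indexKl // flatten_indexKr // cE nth_index //.
  have lt : (flatten_index lam r (index i c) < n)%N.
    by rewrite -[X in (_ < X)%N]sum_lam; apply: flatten_indexP.
  by rewrite (nth_ord_enum i (Ordinal lt)) => /(congr1 val).
by rewrite /lam_block iE flatten_indexKl.
Qed.

Lemma traversal_sigma_lam : traversal sg = map (map (@pos n)) R.
Proof.
apply: traversal_blocks => // c cR; split.
  have /and3P[_ + _] := hlam; apply: contra => /eqP c0.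
  by rewrite -shapeE; apply/mapP; exists c => //; rewrite c0.
have uc : uniq c.
  rewrite -(nth_index [::] cR) nth_reshape take_uniq // drop_uniq //.
  exact: enum_uniq.
rewrite cycle_map; apply: (@sub_in_cycle _ (mem c) _ _ _ _ _ (cycle_next uc)) => [i j ic _|].
  move=> /eqP <-; rewrite /= /step !ffunE /=.
  by rewrite (lam_block_reshape cR).
exact/allP.
Qed.

Lemma flatten_cycles_sigma_lam : flatten (cycles sg) = enum 'I_n.
Proof.
rewrite /cycles traversal_sigma_lam -map_comp.
rewrite (eq_map (g := id)) ?map_id //.
by move=> c /=; rewrite -map_comp map_id.
Qed.

Lemma pi_of_sigma_lam i : pi_of sg i = sabs (sg (pos i)).
Proof.
rewrite /pi_of /eps traversal_sigma_lam -map_flatten.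
by rewrite mem_map ?flattenE ?mem_enum // => j k [].
Qed.

End SigmaCycles.

(** * Moments of words indexed by signed integers *)

Section Transport.
Variables (T T' : finType) (r : T -> T') (h : T' -> T).
Variables (rk : T -> nat) (rk' : T' -> nat).
Hypotheses (rK : cancel r h) (hK : cancel h r) (rkE : forall v, rk' (r v) = rk v).

Definition transport (g : {ffun T -> T}) : {ffun T' -> T'} :=
  [ffun k => r (g (h k))].

Lemma transport_pairings g : (transport g \in pairings T') = (g \in pairings T).
Proof.
apply/pairingsP/pairingsP=> -[gx gK]; split=> v.
- by have := gx (r v); rewrite ffunE rK (can_eq rK).
- by have := gK (r v); rewrite !ffunE !rK => /(can_inj rK).
- by rewrite ffunE -{2}[v]hK (can_eq rK).
by rewrite !ffunE rK gK hK.
Qed.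

Lemma transport_crossings g : crossings rk' (transport g) = crossings rk g.
Proof.
pose f (p : T * T) := (r p.1, r p.2).
have fbij : bijective f.
  by exists (fun p => (h p.1, h p.2)) => -[u v]; rewrite /f /= ?rK ?hK.
rewrite /crossings -(on_card_preimset (f := f)); last exact: onW_bij.
by apply: eq_card => -[u v]; rewrite !inE /= !ffunE !rK !rkE.
Qed.

Lemma sum_pairings_transport (K : comNzRingType) (z : K) (c : T' -> T' -> K) :
  \sum_(g in pairings T') z ^+ crossings rk' g *
      \prod_(k | (rk' k < rk' (g k))%N) c k (g k)
  = \sum_(g in pairings T) z ^+ crossings rk g *
      \prod_(v | (rk v < rk (g v))%N) c (r v) (r (g v)).
Proof.
rewrite (reindex transport) /=; last first.
  exists (fun g' : {ffun T' -> T'} => [ffun v => h (g' (r v))]) => g _.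
    by apply/ffunP=> v; rewrite !ffunE !rK.
  by apply/ffunP=> v; rewrite !ffunE !hK.
apply: eq_big => [g|g _]; first exact: transport_pairings.
rewrite transport_crossings; congr (_ * _).
rewrite (reindex r) /=; last exact/onW_bij/(Bijective rK hK).
apply: eq_big => [v|v _].
  by rewrite ffunE rK !rkE.
by rewrite ffunE rK.
Qed.

End Transport.

Section SignedMoments.
Variable n : nat.

Lemma srank_lt (v : signed n) : (srank v < n.*2)%N.
Proof.
case: v => e i; rewrite /srank /=.
by apply: (@leq_trans i.+1.*2); rewrite ?leq_double // doubleS; case: e; rewrite ?addn0 ?addn1.
Qed.

Definition srank_ord (v : signed n) : 'I_(n.*2) := Ordinal (srank_lt v).

Lemma srank_ord_inj : injective srank_ord.
Proof.
move=> [e i] [e' j] /(congr1 val) /=; rewrite /srank /= => E.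
have ee : e = e'.
  by have := congr1 odd E; rewrite !oddD !odd_double /=; case: e e' {E} => -[].
by rewrite ee in E *; move/addIn/double_inj/val_inj: E => ->.
Qed.

Lemma srank_ord_bij : bijective srank_ord.
Proof.
by apply: inj_card_bij srank_ord_inj _; rewrite card_prod card_bool !card_ord mul2n.
Qed.

(** The order 1, -1, 2, -2, ... puts [pos j] and [neg j] next to each other, so
the factors can be grouped without commuting any of them. *)
Lemma big_signed (A : pzSemiRingType) (f : 'I_(n.*2) -> A) :
  \prod_(k < n.*2) f k = \prod_(j < n) (f (srank_ord (pos j)) * f (srank_ord (neg j))).
Proof.
pose Z k := if insub k is Some k' then f k' else 1.
have ZE k : Z (val k) = f k by rewrite /Z valK.
under eq_bigr do rewrite -ZE.
under [RHS]eq_bigr do rewrite -!ZE /= /srank /= addn0 addn1.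
rewrite -(big_mkord predT Z) -(big_mkord predT (fun j => Z j.*2 * Z j.*2.+1)).
elim: (n) => [|m IH]; first by rewrite !big_nil.
by rewrite doubleS !big_nat_recr //= IH mulrA.
Qed.

Lemma qGaussian_signed (R : realType) (A : algType R[i]) (star : A -> A)
    (tau : {scalar A}) (q : R) (I : Type) (X : I -> A) (y : signed n -> I) :
    qGaussian star tau q X ->
  tau (\prod_(j < n) (X (y (pos j)) * X (y (neg j)))) =
  \sum_(g in F n) q%:C ^+ cr g *
    \prod_(v | (srank v < srank (g v))%N) tau (X (y v) * X (y (g v))).
Proof.
move=> [_ qG]; have [h rK hK] := srank_ord_bij.
have := qG _ (y \o h).
rewrite (big_signed (fun k => X ((y \o h) k))) /=.
under eq_bigr do rewrite !rK.
move=> ->.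
rewrite (sum_pairings_transport rK hK (rk := @srank n) (rk' := @nat_of_ord _) _ _
  (fun k l => tau (X (y (h k)) * X (y (h l))))) //.
apply: eq_bigr => g _; congr (_ * _); apply: eq_bigr => v _.
by rewrite !rK.
Qed.

End SignedMoments.

(** * Expansion of the two sides *)

(** The edges of σ⊚γ are the images under φ of the edges of γ, from which they
inherit their colors, so [pmon_edges] for σ⊚γ is transported back along φ. *)
Lemma pmon_brauer_edges n s d (K : comNzRingType)
    (sg g : {ffun signed n -> signed n})
    (T : pred (signed n)) (t : 'I_n -> 'I_s) (x : 'I_s -> 'M[K]_d) :
    sg \in Fplus n -> g \in Fcol t -> (forall v, T (g v) = ~~ T v) ->
    (forall k, (x k)^T = x k) ->
  pmon (brauer sg g) (tcol sg g t) x = \sum_(b : {ffun 'I_n -> 'I_d})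
    \prod_(v | T v) x (t (sabs v)) (b (sabs (phi sg v))) (b (sabs (phi sg (g v)))).
Proof.
move=> sgF; rewrite inE => /andP[gF /forallP gt] gT xT.
pose phiV := invF (phi_inj sgF).
have phiK : cancel (phi sg) phiV by move=> v; rewrite /phiV invF_f.
have phiVK : cancel phiV (phi sg) by move=> v; rewrite /phiV f_invF.
have brE v : phiV (brauer sg g v) = g (phiV v).
  by rewrite -[v in LHS]phiVK brauer_phi // phiK.
rewrite (@pmon_edges _ _ _ _ (brauer_F sgF gF) _ (T \o phiV)
  (fun v => t (sabs (phiV v)))) //.
- apply: eq_bigr => b _; rewrite (reindex_inj (phi_inj sgF)) /=.
  apply: eq_big => [v|v _]; first by rewrite phiK.
  by rewrite phiK brauer_phi.
- by move=> v /=; rewrite brE gT.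
- by move=> v; rewrite brE; apply/eqP.
by move=> i; apply: tcol_edge => //; rewrite phiVK.
Qed.

(** At the position j the row of the transpose [(Y k)^T] carries b(j) and the
column of [X k] carries b(σ(j)); these are the values of b at |φ(j)| and
|φ(-j)|. *)
Lemma pmon_sigma_expansion (K : nzRingType) n s M N lam (t : 'I_n -> 'I_s)
    (Y X : 'I_s -> 'M[K]_(M, N)) :
    is_partition lam n ->
  let sg := sigma_lam n lam in
  pmon sg t (fun k => (Y k)^T *m X k) =
  \sum_(b : {ffun 'I_n -> 'I_N}) \sum_(a : {ffun 'I_n -> 'I_M})
    \prod_(j < n) (Y (t j) (a j) (b (sabs (phi sg (pos j)))) *
                   X (t j) (a j) (b (sabs (phi sg (neg j))))).
Proof.
move=> hlam sg; have sgF : sg \in F n.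
  by have := sigma_lam_Fplus hlam; rewrite inE => /andP[].
rewrite pmon_cycles //; apply: eq_bigr => b _.
rewrite -(bigA_distr_bigA (fun j a => Y (t j) a (b (sabs (phi sg (pos j)))) *
   X (t j) a (b (sabs (phi sg (neg j)))))).
rewrite flatten_cycles_sigma_lam // enumT [index_enum _]unlock; apply: eq_bigr => j _.
by rewrite mxE pi_of_sigma_lam //; apply: eq_bigr => a _; rewrite mxE.
Qed.

Lemma F_half_edges n (g : {ffun signed n -> signed n}) v :
  g \in F n -> (srank (g v) < srank (g (g v)))%N = ~~ (srank v < srank (g v))%N.
Proof.
case/pairingsP=> gx gK; rewrite gK -leqNgt [RHS]leq_eqVlt.
case: eqP => // e; case/eqP: (gx v).
by apply: (@srank_ord_inj n); apply: val_inj; rewrite /= e.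
Qed.

(** The color factor makes the sum vanish unless γ respects the coloring; when it
does, the sums over row and column indices separate into the two monomials. *)
Lemma sum_colored_edges n s M N (K : comNzRingType) lam (t : 'I_n -> 'I_s)
    (g : {ffun signed n -> signed n})
    (B : 'I_s -> 'M[K]_M) (Sigma : 'I_s -> 'M[K]_N) :
    (forall k, (B k)^T = B k) -> (forall k, (Sigma k)^T = Sigma k) ->
    is_partition lam n -> g \in F n ->
  let sg := sigma_lam n lam in
  \sum_(b : {ffun 'I_n -> 'I_N}) \sum_(a : {ffun 'I_n -> 'I_M})
    \prod_(v | (srank v < srank (g v))%N)
      (B (t (sabs v)) (a (sabs v)) (a (sabs (g v))) *
       Sigma (t (sabs v)) (b (sabs (phi sg v))) (b (sabs (phi sg (g v)))) *
       (t (sabs v) == t (sabs (g v)))%:R)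
  = if g \in Fcol t then
      pmon g t B * pmon (brauer sg g) (tcol sg g t) Sigma
    else 0.
Proof.
move=> BT ST hlam gF sg; have gT v := F_half_edges v gF.
case: ifPn => [gt|]; last first.
  rewrite inE gF /= negb_forall => /existsP[v tv].
  have [w lt_w tw] : exists2 w, (srank w < srank (g w))%N & t (sabs w) != t (sabs (g w)).
    case: (boolP (srank v < srank (g v))%N) => lt_v; first by exists v => //; rewrite eq_sym.
    exists (g v); first by rewrite gT.
    by have /pairingsP[_ ->] := gF.
  rewrite big1 // => b _; rewrite big1 // => a _.
  by rewrite (bigD1 w) //= (negbTE tw) mulr0 mul0r.
have tg v : t (sabs (g v)) = t (sabs v).
  by move: gt; rewrite inE => /andP[_ /forallP/(_ v)/eqP].
rewrite (pmon_brauer_edges (T := fun v => (srank v < srank (g v))%N)) //; last exact: sigma_lam_Fplus.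
rewrite (@pmon_edges _ _ _ _ gF _ (fun v => (srank v < srank (g v))%N)
                     (fun v => t (sabs v))) //.
rewrite big_distrlr exchange_big /=.
apply: eq_bigr => b _; apply: eq_bigr => a _.
by rewrite -big_split /=; apply: eq_bigr => v _; rewrite tg eqxx mulr1.
Qed.

Theorem theorem2p18 (R : realType) (A : algType R[i]) (star : A -> A)
    (hstar : star_algebra star) (tau : {scalar A})
    (htau : tracial_state star tau)
    (q : R) (hq : -1 <= q <= 1) (M N s n : nat)
    (B : 'I_s -> 'M[R]_M) (hB : forall k, posdef (B k))
    (Sigma : 'I_s -> 'M[R]_N) (hSigma : forall k, posdef (Sigma k))
    (lam : seq nat) (hlam : is_partition lam n) (t : 'I_n -> 'I_s)
    (W : 'I_s -> 'M[A]_N)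
    (hW : forall k, qWishart star tau q (Sigma k) (B k) (W k))
    (hWorth : q_orthogonal star tau q Sigma B W) :
  let sigma := sigma_lam n lam in
  tau (pmon sigma t W) =
  (\sum_(g in Fcol t)
     q ^+ cr g * pmon g t B * pmon (brauer sigma g) (tcol sigma g t) Sigma)%:C.
Proof.
move=> sg; have [X [WX qG cov]] := hWorth.
have starX k a b : star (X k a b) = X k a b by have [/(_ (k, a, b))] := qG.
have -> : pmon sg t W = pmon sg t (fun k => (X k)^T *m X k).
  apply: eq_bigr => c _; congr (\tr _); apply: eq_bigr => j _.
  have [-> _ _] := WX (t j); congr (_^T *m _).
  by apply/matrixP=> a b; rewrite mxE starX.
rewrite (pmon_sigma_expansion _ _ _ hlam) -/sg.
pose y (a : {ffun 'I_n -> 'I_M}) (b : {ffun 'I_n -> 'I_N}) (v : signed n) :=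
  (t (sabs v), a (sabs v), b (sabs (phi sg v))).
transitivity (\sum_(b : {ffun 'I_n -> 'I_N}) \sum_(a : {ffun 'I_n -> 'I_M})
   (\sum_(g in F n) q ^+ cr g *
    \prod_(v | (srank v < srank (g v))%N)
      (B (t (sabs v)) (a (sabs v)) (a (sabs (g v))) *
       Sigma (t (sabs v)) (b (sabs (phi sg v))) (b (sabs (phi sg (g v)))) *
       (t (sabs v) == t (sabs (g v)))%:R))%:C).
  rewrite linear_sum; apply: eq_bigr => b _.
  rewrite linear_sum; apply: eq_bigr => a _.
  have := qGaussian_signed (y a b) qG; rewrite /y /= => ->.
  rewrite rmorph_sum; apply: eq_bigr => g _; rewrite rmorphM rmorphXn rmorph_prod.
  by congr (_ * _); apply: eq_bigr => v _; rewrite cov.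
under eq_bigr do rewrite -rmorph_sum.
rewrite -rmorph_sum; congr (_%:C).
under eq_bigr do rewrite exchange_big.
rewrite exchange_big /=.
have -> : \sum_(g in Fcol t)
     q ^+ cr g * pmon g t B * pmon (brauer sg g) (tcol sg g t) Sigma
  = \sum_(g in F n) q ^+ cr g * (if g \in Fcol t then
      pmon g t B * pmon (brauer sg g) (tcol sg g t) Sigma else 0).
  rewrite [RHS](bigID (mem (Fcol t))) /= [X in _ + X]big1 ?addr0; last first.
    by move=> g /andP[_ /negbTE ->]; rewrite mulr0.
  apply: eq_big => [g|g ->]; last by rewrite mulrA.
  by apply/idP/andP => [gt|[]//]; split=> //; case/setIdP: gt.
apply: eq_bigr => g gF.
under eq_bigr do rewrite -mulr_sumr.
rewrite -mulr_sumr; congr (_ * _).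
by apply: sum_colored_edges => // k; [have [] := hB k | have [] := hSigma k].
Qed.
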